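(* Let $q$ be a prime power and let $m,d\ge 1$, $l$, $r$ be integers with $1\leq l\leq m$ and $\binom{m+d}{d}-\binom{m+d+1-l}{d} <r \leq \binom{m+d}{d}$. Given $F_1, \dots, F_r \in S_d(m)$ that are linearly independent over $\mathbb{F}_q$, we have $$\dim(V(F_1, \dots, F_r)) \leq m-l.$$
   Context: $\mathbb{F}_q$ is the finite field with $q$ elements and $\overline{\mathbb{F}}_q$ its algebraic closure. $S_d(m)$ is the $\mathbb{F}_q$-vector space of homogeneous polynomials of degree $d$ in $\mathbb{F}_q[x_0,\dots,x_m]$ (together with $0$). $V(F_1,\dots,F_r)\subseteq\mathbb{P}^m(\overline{\mathbb{F}}_q)$ is the common zero set of the $F_i$, a projective algebraic set over $\overline{\mathbb{F}}_q$; its dimension is its dimension as an algebraic set (the empty set has negative dimension). *)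

(* Defs.v *)
From mathcomp Require Import all_boot all_order all_algebra all_field.
From mathcomp Require Import boolp classical_sets.
(* The notation levels of constructive_ereal clash with those of mpoly. *)
From mathcomp Require Import -(notations) constructive_ereal.
From mathcomp.multinomials Require Import mpoly.

Set Implicit Arguments.
Unset Strict Implicit.
Unset Printing Implicit Defensive.

Import GRing.Theory.

Local Open Scope classical_set_scope.
Local Open Scope ring_scope.

(* P^m(K): a point is a line through the origin of K^(m+1). *)
Definition pspace (K : fieldType) (m : nat) : Type :=
  {L : {vspace 'rV[K]_m.+1} | \dim L == 1%N}.

(* The nonzero vectors of L are the homogeneous coordinates of the point.
   Meaningful for homogeneous G, for which one may equivalently test a single
   choice of coordinates. *)
Definition vanishes_at (K : fieldType) (m : nat)
    (G : {mpoly K[m.+1]}) (P : pspace K m) : Prop :=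
  forall v : 'rV[K]_m.+1, v \in sval P -> v != 0 -> G.@[fun i => v 0 i] = 0.

Definition zero_locus (K : fieldType) (m : nat)
    (S : set {mpoly K[m.+1]}) : set (pspace K m) :=
  [set P | forall G, S G -> vanishes_at G P].

Definition zariski_closed (K : fieldType) (m : nat)
    (A : set (pspace K m)) : Prop :=
  exists2 S : set {mpoly K[m.+1]},
    (forall G, S G -> exists e : nat, G \is e.-homog) & A = zero_locus S.

Definition zariski_irreducible (K : fieldType) (m : nat)
    (Z : set (pspace K m)) : Prop :=
  Z !=set0 /\
  forall A B : set (pspace K m), zariski_closed A -> zariski_closed B ->
    Z `<=` A `|` B -> Z `<=` A \/ Z `<=` B.

(* There is a chain Z_0 < Z_1 < ... < Z_n of n + 1 irreducible closed sets
   contained in X; values Z i for i > n are irrelevant. *)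
Definition irreducible_chain (K : fieldType) (m : nat)
    (X : set (pspace K m)) (n : nat) : Prop :=
  exists Z : nat -> set (pspace K m),
    (forall i : nat, (i <= n)%N ->
       [/\ zariski_closed (Z i), zariski_irreducible (Z i) & Z i `<=` X]) /\
    (forall i : nat, (i < n)%N -> Z i `<` Z i.+1).

(* Dimension of a projective algebraic set X: the supremum in extended int of the
   lengths n of its chains, so that proj_dim X = ENInf exactly when there is no chain
   (in particular for X empty) and proj_dim X = EPInf when lengths are unbounded.
   X is meant to be closed in P^m, so that a closed subset of X is the same as
   a closed subset of P^m contained in X. *)
Definition proj_dim (K : fieldType) (m : nat) (X : set (pspace K m)) : extended int :=
  if pselect (exists n, irreducible_chain X n) is left _ then
    if pselect (exists n, irreducible_chain X n /\
                  forall k, irreducible_chain X k -> (k <= n)%N)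
      is left maxX then EFin (sval (cid maxX))%:Z
    else EPInf int
  else ENInf int.

(* V(F_1, ..., F_r) in P^m(K), for forms F_i with coefficients in a subfield k
   of K embedded by iota. *)
Definition proj_V (k K : fieldType) (iota : {rmorphism k -> K}) (m d r : nat)
    (Fs : r.-tuple (dhomog m.+1 k d)) : set (pspace K m) :=
  zero_locus [set map_mpoly iota (tnth Fs i : {mpoly k[m.+1]}) | i in [set: 'I_r]].

(* Main.v *)
Require Import Defs.
From HB Require Import structures.
From mathcomp Require Import all_boot all_order all_algebra all_field.
From mathcomp Require Import boolp classical_sets.
From mathcomp Require Import -(notations) constructive_ereal.
From mathcomp.multinomials Require Import mpoly.
From mathcomp Require Import zify.

Set Implicit Arguments.
Unset Strict Implicit.
Unset Printing Implicit Defensive.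

Import Order.TTheory GRing.Theory.

Local Open Scope ring_scope.

(** Let Z_0 < ... < Z_n be a chain of irreducible closed subsets of
    V(F_1, ..., F_r), and let h(d) be the Hilbert function of Z_n, the dimension
    of the space of forms of degree d modulo those vanishing on Z_n.  The theorem
    compares two bounds on h(d).  The r independent forms F_i vanish on Z_n, so
    h(d) <= C(m + d, d) - r.  An irreducible set carrying a chain of length n has
    h(d) >= C(n + d, d) in every degree d.  Together with the hypothesis on r
    they give C(n + d, d) < C(m + 1 - l + d, d), hence n <= m - l.

    The lower bound is usually derived from Noether normalization; it is obtained
    here by Groebner degeneration.  Call a monomial standard when it is not the
    leading monomial of a form vanishing on Z_n; by linear algebra h(d) is the
    number of standard monomials of degree d.

    - Growth (hilbert_growth).  If f is a form of degree e vanishing on Z_(i-1)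
      but not on Z_i, multiplication by f is injective modulo the prime ideal of
      Z_i and lands in the ideal of Z_(i-1).  Hence the Hilbert function of Z_i
      in degree e + d is at least its value in degree d plus the Hilbert function
      of Z_(i-1) in degree e + d.  Iterating this along the multiples of a
      suitable e, Pascal's rule gives h(e N) >= C(N + n, n) for all N.

    - From growth to all degrees (growth_supported).  Divisors of standard
      monomials are standard.  If every set of n + 1 variables supported a
      non-standard monomial, a standard monomial would have at most n large
      exponents, and there would be only O(N^n) standard monomials of degree at
      most e N, whereas the growth just found, summed over the degrees e j with
      j <= N, gives C(N + n + 1, n + 1) of them.  So there are n + 1 variables
      all of whose monomials are standard, and C(n + d, d) of these have
      degree d.

    For the upper bound, independence over the small field is turned into leading
    monomials before scalars are extended: the span of the F_i contains forms
    with r distinct leading monomials, and these are kept when coefficients are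
    mapped into the big field (forms_le_leads). *)

(** * Forms and their leading monomials *)

Definition monomials n d : seq 'X_{1..n} :=
  [seq s2m t | t : d.-tuple 'I_n <- enum (basis n d)].

Lemma mem_monomials n d (mu : 'X_{1..n}) :
  (mu \in monomials n d) = (mdeg mu == d).
Proof. by rewrite basis_cover. Qed.

Lemma monomials_uniq n d : uniq (monomials n d).
Proof. exact: uniq_basis. Qed.

Lemma size_monomials n d : size (monomials n.+1 d) = 'C(n + d, d).
Proof. by rewrite size_basis addnC. Qed.

Lemma dim_dhomog (k : fieldType) n d :
  \dim {: dhomog n.+1 k d} = 'C(n + d, d).
Proof. by rewrite dimvf addnC. Qed.

Definition coefs (k : fieldType) n d (s : seq 'X_{1..n})
    (u : dhomog n k d) : 'rV[k]_(size s) :=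
  \row_i (val u)@_(nth 0%MM s i).

Lemma coefs_is_linear (k : fieldType) n d s : linear (@coefs k n d s).
Proof. by move=> c u v; apply/rowP=> i; rewrite !mxE /= mcoeffD mcoeffZ. Qed.

HB.instance Definition _ (k : fieldType) n d s :=
  GRing.isLinear.Build k (dhomog n k d) 'rV[k]_(size s) _ (@coefs k n d s)
    (@coefs_is_linear k n d s).

(** A nonzero form has a nonzero coefficient at its leading monomial, so the
    coefficients at the monomials of s determine an element of U. *)
Lemma dim_le_size_leads (k : fieldType) n d (U : {vspace dhomog n.+1 k d})
    (s : seq 'X_{1..n.+1}) :
    (forall u, u \in U -> u != 0 -> mlead (val u) \in s) ->
  (\dim U <= size s)%N.
Proof.
move=> leadU; pose L := linfun (@coefs k n.+1 d s).
suff /limg_dim_eq <- : (U :&: lker L)%VS = 0%VS.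
  by apply: leq_trans (dimvS (subvf _)) _; rewrite dimvf /dim /= mul1n.
apply/eqP; rewrite -subv0; apply/subvP=> u; rewrite memv_cap memv_ker memv0.
case/andP=> uU /eqP Lu0; apply: contraT => u_n0.
have /rowP := Lu0; rewrite lfunE /= => coef0.
have lead_s := leadU u uU u_n0.
have lt_i : (index (mlead (val u)) s < size s)%N by rewrite index_mem.
have := coef0 (Ordinal lt_i); rewrite !mxE /= nth_index // => /eqP.
by rewrite mleadc_eq0 -[_ == 0]/(u == 0) (negbTE u_n0).
Qed.

(** In decreasing order of leading monomials, each polynomial is the last with
    a nonzero coefficient at its own leading monomial: the system is
    triangular. *)
Lemma free_distinct_leads (k : fieldType) n d (s : seq 'X_{1..n.+1})
    (g : 'X_{1..n.+1} -> dhomog n.+1 k d) :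
    uniq s -> (forall mu, mu \in s -> g mu != 0 /\ mlead (val (g mu)) = mu) ->
  free (map g s).
Proof.
move=> s_uniq leadg.
pose t := rev (sort <=%O s).
have st : perm_eq t s by rewrite perm_rev (permEl (perm_sort <=%O s)).
have t_sorted : sorted >%O t by rewrite rev_sorted sort_lt_sorted.
rewrite -(perm_free (perm_map g st)).
have {}leadg mu : mu \in t -> g mu != 0 /\ mlead (val (g mu)) = mu.
  by rewrite (perm_mem st); exact: leadg.
elim: t t_sorted leadg {st} => [|mu t IHt] /=; first by rewrite nil_free.
move=> t_sorted leadg; rewrite free_cons.
apply/andP; split; last first.
  apply: IHt (path_sorted t_sorted) _ => nu nut.
  by apply: leadg; rewrite inE nut orbT.
have [gmu_n0 lead_gmu] := leadg mu (mem_head _ _).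
pose L := linfun (@coefs k n.+1 d [:: mu]).
(* L reads off the coefficient at mu, which vanishes on all smaller leads. *)
have sub_ker : (<<map g t>> <= lker L)%VS.
  apply/span_subvP=> _ /mapP[nu nut ->]; rewrite memv_ker lfunE /=.
  apply/eqP/rowP=> i; rewrite !mxE ord1 /= mcoeff_gt_mlead //.
  have [_ ->] := leadg nu ltac:(by rewrite inE nut orbT).
  by have /allP/(_ nu nut) := order_path_min (rev_trans lt_trans) t_sorted.
apply: contra gmu_n0 => /(subvP sub_ker); rewrite memv_ker lfunE /=.
move=> /eqP/rowP/(_ 0); rewrite !mxE /= -[X in _@_X]lead_gmu => /eqP.
by rewrite mleadc_eq0.
Qed.

(** Only forms of I count, so that the standard monomials of degree d measure I
    in degree d alone. *)
Definition leads (k : fieldType) n (I : {mpoly k[n]} -> Prop) (mu : 'X_{1..n}) :=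
  exists g, [/\ I g, g \is (mdeg mu).-homog, g != 0 & mlead g = mu].

Definition standard (k : fieldType) n (I : {mpoly k[n]} -> Prop) : pred 'X_{1..n} :=
  fun mu => ~~ `[< leads I mu >].

Definition linear_closed_prop (k : fieldType) n (I : {mpoly k[n]} -> Prop) :=
  I 0 /\ forall c p q, I p -> I q -> I (c *: p + q).

(** Half of the equality between the Hilbert function of I and the number of
    standard monomials: forms in I realizing the other leading monomials of
    degree d are independent, their span meets U trivially, and together with U
    it fits in a space whose dimension is the number of all monomials. *)
Lemma dim_le_standard (k : fieldType) n d (I : {mpoly k[n.+1]} -> Prop)
    (U : {vspace dhomog n.+1 k d}) :
    linear_closed_prop I -> (forall u, u \in U -> I (val u) -> u = 0) ->
  (\dim U <= count (standard I) (monomials n.+1 d))%N.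
Proof.
move=> [I0 Ilin] UI0.
pose s := [seq mu <- monomials n.+1 d | ~~ standard I mu].
have gP mu : exists g : dhomog n.+1 k d,
    mu \in s -> [/\ I (val g), g != 0 & mlead (val g) = mu].
  case: (boolP (mu \in s)) => [|_]; last by exists 0.
  rewrite mem_filter negbK mem_monomials => /andP[/asboolP[g [Ig hg g0 lg]]].
  by move=> /eqP degmu; rewrite degmu in hg; exists (DHomog hg).
have [g {}gP] := choice gP.
pose G := <<map g s>>%VS.
have dimG : \dim G = size s.
  rewrite -(size_map g); apply/eqP; apply: free_distinct_leads.
    by rewrite filter_uniq // monomials_uniq.
  by move=> mu /gP[].
have GI u : u \in G -> I (val u).
  move=> /(@coord_span _ _ _ (in_tuple (map g s)) _) ->.
  elim/big_rec: _ => //= i v _ Iv.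
  rewrite /=; apply: Ilin => //.
  have /mapP[mu mus ->] : nth 0 (map g s) i \in map g s by rewrite mem_nth.
  by have [] := gP mu mus.
have GU0 : (G :&: U = 0)%VS.
  apply/eqP; rewrite -subv0; apply/subvP=> u; rewrite memv_cap memv0.
  by case/andP=> /GI Iu /UI0 /(_ Iu) ->.
rewrite -(leq_add2l (size s)) -{1}dimG -dimv_disjoint_sum //.
apply: leq_trans (dimvS (subvf _)) _.
have -> : size s = count (predC (standard I)) (monomials n.+1 d).
  by rewrite size_filter.
by rewrite dim_dhomog -size_monomials -(count_predC (standard I)) addnC.
Qed.

(** * Forms vanishing on an irreducible closed set *)

Definition vanishing_on (K : fieldType) m (Z : set (pspace K m))
    (G : {mpoly K[m.+1]}) : Prop :=
  forall P, Z P -> vanishes_at G P.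

Lemma vanishing_on_linear (K : fieldType) m (Z : set (pspace K m)) :
  linear_closed_prop (vanishing_on Z).
Proof.
split=> [P _ v _ _|c p q Zp Zq P ZP v vP v0]; first by rewrite meval0.
by rewrite mevalD mevalZ (Zp P) // (Zq P) // mulr0 addr0.
Qed.

Lemma meval_homog (K : fieldType) n d (G : {mpoly K[n]}) (c : K) (v : 'I_n -> K) :
  G \is d.-homog -> G.@[fun i => c * v i] = c ^+ d * G.@[v].
Proof.
move=> /dhomogP homG; rewrite !mevalE mulr_sumr big_seq [RHS]big_seq.
apply: eq_bigr => mu /homG <-; rewrite mulrCA; congr (_ * _).
under eq_bigr do rewrite exprMn.
by rewrite big_split /= mdegE expr_sum.
Qed.

(** Vanishing at a point may be tested on one choice of coordinates. *)
Lemma vanishes_at_homog (K : fieldType) m d (G : {mpoly K[m.+1]})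
    (P : pspace K m) (v : 'rV[K]_m.+1) :
    G \is d.-homog -> v \in sval P -> v != 0 -> G.@[fun i => v 0 i] = 0 ->
  vanishes_at G P.
Proof.
case: P => L Ldim homG /= vL v0 Gv w /= wL _.
have dimL := eqP Ldim.
move: wL; have <- : <[v]>%VS = L.
  by apply/eqP; rewrite eqEdim -memvE vL dimL dim_vline v0.
case/vlineP=> c ->; rewrite (@meval_eq _ _ _ (fun i => c * v 0 i)); last first.
  by move=> i; rewrite mxE.
by rewrite (meval_homog _ _ homG) Gv mulr0.
Qed.

Lemma pspace_coords (K : fieldType) m (P : pspace K m) :
  exists2 v : 'rV[K]_m.+1, v \in sval P & v != 0.
Proof.
case: P => L /= /eqP dimL; exists (vpick L); first exact: memv_pick.
by rewrite vpick0 -dimv_eq0 dimL.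
Qed.

(** The homogeneous ideal of an irreducible set is prime: Z is covered by the
    zero loci of f and g. *)
Lemma vanishing_on_prime (K : fieldType) m (Z : set (pspace K m)) d e
    (f g : {mpoly K[m.+1]}) :
    zariski_irreducible Z -> f \is d.-homog -> g \is e.-homog ->
    vanishing_on Z (f * g) ->
  vanishing_on Z f \/ vanishing_on Z g.
Proof.
move=> [_ Zirr] homf homg Zfg.
pose V h := @zero_locus K m [set h]%classic.
have ZV h : (Z `<=` V h)%classic -> vanishing_on Z h.
  by move=> sub P ZP; apply: (sub P ZP).
have V_closed h c : h \is c.-homog -> zariski_closed (V h).
  by move=> homh; exists [set h]%classic => // _ ->; exists c.
suff /(Zirr _ _ (V_closed _ _ homf) (V_closed _ _ homg))[?|?] :
    (Z `<=` V f `|` V g)%classic by [left; exact: ZV|right; exact: ZV].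
move=> P ZP; have [v vP v0] := pspace_coords P.
have /eqP := Zfg P ZP v vP v0; rewrite mevalM mulf_eq0.
by case/orP=> /eqP Gv; [left|right] => _ ->;
  [apply: vanishes_at_homog homf _ _ Gv | apply: vanishes_at_homog homg _ _ Gv].
Qed.

Lemma vanishing_onX (K : fieldType) m (Z : set (pspace K m)) d k
    (f : {mpoly K[m.+1]}) :
    zariski_irreducible Z -> f \is d.-homog -> ~ vanishing_on Z f ->
  ~ vanishing_on Z (f ^+ k).
Proof.
move=> Zirr homf Zf; elim: k => [|k IHk].
  case: Zirr => -[P ZP] _ Z1; have [v vP v0] := pspace_coords P.
  by have /eqP := Z1 P ZP v vP v0; rewrite expr0 meval1 oner_eq0.
rewrite exprS => Zfk.
by case: (vanishing_on_prime Zirr homf (dhomogMn k homf) Zfk).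
Qed.

(** * Growth of the Hilbert function along a chain *)

Section MulForm.
Context (K : fieldType) (n e d : nat) (f : {mpoly K[n]}).
Hypothesis homf : f \is e.-homog.

Definition mul_form (u : dhomog n K d) : dhomog n K (e + d) :=
  DHomog (dhomogM homf (valP u)).

Lemma mul_form_is_linear : linear mul_form.
Proof. by move=> c u v; apply: val_inj; rewrite /= mulrDr scalerAr. Qed.

HB.instance Definition _ :=
  GRing.isLinear.Build K (dhomog n K d) (dhomog n K (e + d)) _ mul_form
    mul_form_is_linear.
End MulForm.

(** The value in degree d of the Hilbert function of Z is at least N. *)
Definition independent_mod (K : fieldType) m (Z : set (pspace K m)) (d N : nat) :=
  exists2 U : {vspace dhomog m.+1 K d}, (N <= \dim U)%N &
    forall u, u \in U -> vanishing_on Z (val u) -> u = 0.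

Lemma independent_mod_le (K : fieldType) m (Z : set (pspace K m)) d a b :
  (a <= b)%N -> independent_mod Z d b -> independent_mod Z d a.
Proof. by move=> ab [U bU ZU]; exists U => //; apply: leq_trans bU. Qed.

(** U is a space of forms independent modulo the ideal of Z, and W one for Y.  As
    f vanishes on Y, a relation f u + w = 0 modulo the ideal of Z first forces
    w = 0, and then u = 0 since that ideal is prime and f is not in it. *)
Lemma independent_mod_step (K : fieldType) m (Y Z : set (pspace K m)) e d a b
    (f : {mpoly K[m.+1]}) :
    zariski_irreducible Z -> (Y `<=` Z)%classic -> f \is e.-homog ->
    vanishing_on Y f -> ~ vanishing_on Z f ->
    independent_mod Z d a -> independent_mod Y (e + d) b ->
  independent_mod Z (e + d) (a + b).
Proof.
move=> Zirr YZ homf Yf Zf [U aU ZU] [W bW YW].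
pose L := linfun (mul_form (d := d) homf).
have mulU u : u \in U -> vanishing_on Z (val (L u)) -> u = 0.
  move=> uU; rewrite lfunE /= => Zfu.
  case: (vanishing_on_prime Zirr homf (valP u) Zfu) => //.
  exact: ZU.
have Lw w : w \in (L @: U)%VS -> vanishing_on Y (val w).
  move=> /memv_imgP[u uU ->] P YP v vP v0; rewrite lfunE /=.
  by rewrite mevalM (Yf P) // mul0r.
have ZW u w : u \in U -> w \in W -> vanishing_on Z (val (L u + w)) ->
    u = 0 /\ w = 0.
  move=> uU wW Zuw.
  have w0 : w = 0.
    apply: YW => // P YP v vP v0.
    have := Zuw P (YZ P YP) v vP v0; rewrite /= mevalD.
    by rewrite (Lw _ (memv_img L uU) P) ?add0r.
  by split=> //; apply: mulU => //; move: Zuw; rewrite w0 addr0.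
have Z0 : vanishing_on Z 0 by case: (vanishing_on_linear Z).
exists (L @: U + W)%VS.
  rewrite dimv_disjoint_sum.
    apply: leq_add bW; rewrite limg_dim_eq //.
    apply/eqP; rewrite -subv0; apply/subvP=> u.
    rewrite memv_cap memv_ker memv0 => /andP[uU /eqP Lu].
    by apply/eqP/mulU => //; rewrite Lu.
  apply/eqP; rewrite -subv0; apply/subvP=> w.
  rewrite memv_cap memv0 => /andP[/memv_imgP[u uU ->] LuW].
  by have [||-> _] := ZW u (- L u) uU; rewrite ?memvN ?subrr ?linear0.
move=> _ /memv_addP[_ /memv_imgP[u uU ->] [w wW ->]] Zuw.
by have [-> ->] := ZW u w uU wW Zuw; rewrite linear0 addr0.
Qed.

(** The set Z_0 is nonempty, so some variable does not vanish on it and all powers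
    of that variable are nonzero modulo its ideal.  For the step, the form f has
    an arbitrary degree c whereas the bound for Z_i is known in multiples of e;
    replacing f by its e-th power makes multiples of c e suit both. *)
Lemma hilbert_growth (K : fieldType) m (Z : nat -> set (pspace K m)) i :
    (forall j, (j <= i)%N -> zariski_closed (Z j) /\ zariski_irreducible (Z j)) ->
    (forall j, (j < i)%N -> (Z j `<` Z j.+1)%classic) ->
  exists2 e, (0 < e)%N & forall N, independent_mod (Z i) (e * N) 'C(N + i, i).
Proof.
elim: i => [|i IHi] Zirr ZS.
  have [_ Z0irr] := Zirr 0 isT; have [[P ZP] _] := Z0irr.
  have [v vP /eqP v0] := pspace_coords P.
  have [j vj] : exists j, v 0 j != 0.
    apply: contrapT => nex; apply: v0; apply/rowP => j; rewrite mxE.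
    by apply/eqP; apply: contraT => vj; case: nex; exists j.
  have homX : ('X_j : {mpoly K[m.+1]}) \is 1.-homog by rewrite dhomogX /= mdeg1.
  exists 1 => // N; rewrite addn0 bin0 mul1n.
  have homXN : ('X_j ^+ N : {mpoly K[m.+1]}) \is N.-homog.
    by rewrite -[N in X in _ \is X]mul1n dhomogMn.
  have nZX : ~ vanishing_on (Z 0) ('X_j ^+ N).
    apply: (vanishing_onX Z0irr homX) => ZX; have /eqP := ZX P ZP v vP (introN eqP v0).
    by rewrite mevalXU (negbTE vj).
  exists <[DHomog homXN]>%VS.
    rewrite dim_vline; case: eqP => // /(congr1 val) /= X0.
    by case: nZX; rewrite X0; case: (vanishing_on_linear (Z 0)).
  move=> _ /vlineP[c ->] /=; have [->|c0] := eqVneq c 0; first by rewrite scale0r.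
  move=> ZcX; case: nZX => Q ZQ w wQ w0; have /eqP := ZcX Q ZQ w wQ w0.
  by rewrite mevalZ mulf_eq0 (negbTE c0) => /eqP.
have [|j ji|e e_gt0 grow] := IHi; first by move=> j ji; apply: Zirr; exact: leqW.
  by apply: ZS; exact: leqW.
have [[S homS ZE] _] := Zirr i (leqnSn i).
have [_ Zi1irr] := Zirr i.+1 (leqnn _).
have [sub nsub] := ZS i (leqnn _).
have [f [c homf] [Yf Zf]] : exists2 f, (exists c, f \is c.-homog) &
    vanishing_on (Z i) f /\ ~ vanishing_on (Z i.+1) f.
  apply: contrapT => nex; apply: nsub => P ZP; rewrite ZE => f Sf.
  apply: contrapT => nfP; apply: nex; exists f; first exact: homS.
  by split=> [Q|/(_ P ZP)//]; rewrite ZE; apply.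
(* If c = 0, then f is constant; being 0 at a point of Z i, it would vanish
   everywhere. *)
have c_gt0 : (0 < c)%N.
  rewrite lt0n; apply/eqP => c0; rewrite c0 in homf; apply: Zf => Q _ w _ _.
  have [_ [[P ZP] _]] := Zirr i (leqnSn i).
  have [v vP v0] := pspace_coords P.
  rewrite -[LHS]mul1r -(expr0 0) -(meval_homog 0 _ homf).
  rewrite -[RHS](Yf P ZP v vP v0) -[RHS]mul1r -(expr0 0) -(meval_homog 0 _ homf).
  by apply: meval_eq => j; rewrite !mul0r.
exists (c * e)%N => [|N]; first by rewrite muln_gt0 c_gt0.
have {}grow M : independent_mod (Z i) (c * e * M) 'C(M + i, i).
  have -> : (c * e * M = e * (c * M))%N by rewrite mulnCA mulnA.
  apply: independent_mod_le (grow (c * M)%N).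
  by apply: leq_bin2l; rewrite leq_add2r leq_pmull.
elim: N => [|N IHN].
  have [U dU ZU] := grow 0; exists U; first by rewrite binn -(binn i).
  by move=> u uU Zu; apply: ZU => // P /sub; apply: Zu.
have -> : 'C(N.+1 + i.+1, i.+1) = ('C(N + i.+1, i.+1) + 'C(N.+1 + i, i))%N.
  by rewrite addSn binS addnS.
have -> : (c * e * N.+1 = c * e + c * e * N)%N by rewrite mulnS.
apply: (independent_mod_step Zi1irr sub (dhomogMn e homf)) => //.
- by move=> P ZP v vP v0; rewrite -(prednK e_gt0) exprS mevalM (Yf P) // mul0r.
- exact: vanishing_onX Zi1irr homf Zf.
- by rewrite -mulnS.
Qed.

(** * Monomial sets with polynomial growth *)

Lemma sum_bin_diag n N : (\sum_(j < N.+1) 'C(j + n, n) = 'C(N + n.+1, n.+1))%N.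
Proof.
elim: N => [|N IHN]; first by rewrite big_ord1 !binn.
by rewrite big_ord_recr /= IHN addSnnS [in RHS]addSn binS.
Qed.

Lemma leq_exp_ffact N b : (N.+1 ^ b <= (N + b) ^_ b)%N.
Proof.
elim: b => [|b IHb] //; rewrite addnS ffactSS expnS leq_mul //.
by rewrite ltnS leq_addr.
Qed.

Lemma card_bigcup_le (I T : finType) (P : pred I) (F : I -> {set T}) :
  (#|\bigcup_(i | P i) F i| <= \sum_(i | P i) #|F i|)%N.
Proof.
elim/big_rec2: _ => [|i a A _ IH]; first by rewrite cards0.
by apply: leq_trans (leq_card_setU _ _) _; rewrite leq_add2l.
Qed.

(** Exponent vectors below A whose entries outside T are below D: only the
    entries in T, at most n of them, are free to grow with A. *)
Lemma card_large_inside k A D (T : {set 'I_k}) n :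
    (0 < A)%N -> (0 < D)%N -> (#|T| <= n)%N ->
  (#|[set f : {ffun 'I_k -> 'I_A} | [forall (i | i \notin T), (f i < D)%N]]|
     <= A ^ n * D ^ k)%N.
Proof.
move=> A0 D0 Tn.
pose F (i : 'I_k) : pred 'I_A := fun x => (i \in T) || (x < D)%N.
have -> : #|[set f : {ffun 'I_k -> 'I_A} | [forall (i | i \notin T), (f i < D)%N]]|
   = #|(family F : pred {ffun 'I_k -> 'I_A})|.
  apply: eq_card => f; rewrite inE; apply/forall_inP/familyP => H i.
    by rewrite unfold_in /F; case: (boolP (i \in T)) => // /H.
  by move=> iT; have := H i; rewrite unfold_in /F (negbTE iT).
rewrite card_family foldrE big_map big_enum /=.
apply: leq_trans (_ : \prod_(i < k) ((if i \in T then A else 1) * D) <= _)%N.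
  apply: leq_prod => i _; case: ifP => iT.
    by apply: leq_trans (max_card _) _; rewrite card_ord leq_pmulr.
  rewrite mul1n -[X in (_ <= X)%N]card_ord.
  have [AD|DA] := leqP A D.
    by apply: leq_trans (max_card _) _; rewrite !card_ord.
  rewrite -(card_image (f := widen_ord (ltnW DA))); last first.
    by move=> x y /(congr1 val) /= /val_inj.
  apply/subset_leq_card/fintype.subsetP => x; rewrite unfold_in /F iT /= => xD.
  by apply/fintype.imageP; exists (Ordinal xD) => //; apply: val_inj.
rewrite big_split /= prod_nat_const card_ord leq_mul2r; apply/orP; right.
by rewrite -big_mkcond /= prod_nat_const leq_pexp2l.
Qed.

Definition supported_on k (J : {set 'I_k}) (mu : 'X_{1..k}) :=
  forall i, i \notin J -> mu i = 0%N.

(** Suppose that every J with more than n elements supports a monomial g J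
    outside M, and let D exceed all degrees of the g J.  If the set T of exponents
    of a monomial of M that reach D had more than n elements, g T would divide
    that monomial.  So monomials of M have at most n large exponents, and
    card_large_inside bounds the number of those of degree at most e N by a
    multiple of (N + 1) ^ n.
    Summing the growth hypothesis over the degrees e j, j <= N, gives a number of
    order N ^ (n + 1). *)
Lemma growth_supported k n e (M : pred 'X_{1..k}) :
    (forall mu nu, M (mu + nu)%MM -> M mu) -> (0 < e)%N ->
    (forall N, 'C(N + n, n) <= count M (monomials k (e * N)))%N ->
  exists2 J : {set 'I_k}, (n < #|J|)%N & forall mu, supported_on J mu -> M mu.
Proof.
move=> Mdiv e0 grow; apply: contrapT => nJ.
have gP (J : {set 'I_k}) : exists mu, (n < #|J|)%N -> supported_on J mu /\ ~~ M mu.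
  apply: contrapT => nmu; apply: nJ; exists J.
    by rewrite ltnNge; apply/negP => Jn; apply: nmu; exists 0%MM; rewrite ltnNge Jn.
  move=> mu Jmu; apply: contrapT => /negP nM; apply: nmu; exists mu; by split.
have [g {}gP] := choice gP.
pose D := (\max_(J : {set 'I_k}) mdeg (g J)).+1.
have few mu : M mu -> (#|[set i | (D <= mu i)%N]| <= n)%N.
  move=> Mmu; set T := [set i | _]; rewrite leqNgt; apply/negP => /gP[gT].
  case/negP; apply: (Mdiv _ (mu - g T)%MM); rewrite addmC submK //.
  apply/mnm_lepP => i; have [|iT] := boolP (i \in T); last by rewrite gT.
  rewrite inE => Dmu; apply: leq_trans Dmu; apply: ltnW; rewrite ltnS.
  apply: leq_trans (@leq_bigmax _ (fun J => mdeg (g J)) T); rewrite mdegE (bigD1 i) //=.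
  exact: leq_addr.
(* B is the constant of the upper bound N.+1 ^ n.+1 <= B * N.+1 ^ n, which fails
   as soon as N = B. *)
pose B := ((n.+1)`! * (#|{set 'I_k}| * D ^ k) * e ^ n)%N.
pose N := B; pose A := (e * N).+1.
pose toM (f : {ffun 'I_k -> 'I_A}) : 'X_{1..k} := [multinom val (f i) | i < k].
pose S := [set f | M (toM f)].
have upper : (#|S| <= #|{set 'I_k}| * (A ^ n * D ^ k))%N.
  pose F (T : {set 'I_k}) :=
    [set f : {ffun 'I_k -> 'I_A} | [forall (i | i \notin T), (f i < D)%N]].
  have sub : S \subset \bigcup_(T : {set 'I_k} | (#|T| <= n)%N) F T.
    apply/fintype.subsetP => f; rewrite inE => /few le_n; apply/bigcupP.
    exists [set i | (D <= toM f i)%N] => //; rewrite inE.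
    by apply/forallP => i; rewrite inE mnmE -ltnNge; apply/implyP.
  apply: leq_trans (subset_leq_card sub) _.
  apply: leq_trans (card_bigcup_le _ _) _.
  apply: leq_trans (_ : \sum_(T : {set 'I_k} | (#|T| <= n)%N)
      (A ^ n * D ^ k) <= _)%N.
    by apply: leq_sum => T Tn; apply: card_large_inside.
  by rewrite sum_nat_const leq_mul2r max_card orbT.
have lower : ('C(N + n.+1, n.+1) <= #|S|)%N.
  rewrite -sum_bin_diag.
  apply: leq_trans (_ : \sum_(j < N.+1)
      #|[set f in S | mdeg (toM f) == e * j]| <= _)%N.
    apply: leq_sum => j _; apply: leq_trans (grow j) _.
    rewrite -size_filter cardE.
    pose toF (mu : 'X_{1..k}) : {ffun 'I_k -> 'I_A} := [ffun i => inord (mu i)].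
    have toFK mu : mu \in [seq x <- monomials k (e * j) | M x] -> toM (toF mu) = mu.
      rewrite mem_filter mem_monomials => /andP[_ /eqP degmu].
      apply/mnmP => i; rewrite mnmE ffunE /= inordK // ltnS.
      apply: leq_trans (_ : e * j <= _)%N; last first.
        by rewrite leq_mul2l -ltnS ltn_ord orbT.
      by rewrite -degmu mdegE (bigD1 i) //= leq_addr.
    rewrite -(size_map toF); apply: uniq_leq_size.
      rewrite map_inj_in_uniq ?filter_uniq ?monomials_uniq //.
      exact: can_in_inj toFK.
    move=> _ /mapP[mu muM ->]; rewrite mem_enum !inE toFK //.
    by move: muM; rewrite mem_filter mem_monomials.
  have cardE_sum (j : 'I_N.+1) : #|[set f in S | mdeg (toM f) == e * j]%N| =
      (\sum_(f in S) (mdeg (toM f) == e * j))%N.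
    rewrite -sum1_card.
    rewrite (eq_bigl (fun f => (f \in S) && (mdeg (toM f) == e * j)%N)).
      by rewrite big_mkcondr; apply: eq_bigr => f _; case: eqP.
    by move=> f; rewrite finset.in_set.
  under eq_bigr do rewrite cardE_sum.
  rewrite exchange_big /= -sum1_card; apply: leq_sum => f _.
  pose one_if (j : 'I_N.+1) := (if mdeg (toM f) == e * j then 1 else 0)%N.
  rewrite (eq_bigr one_if); last by rewrite /one_if => j _; case: eqP.
  (* As e > 0, a monomial has degree e j for at most one j. *)
  rewrite -big_mkcond sum1_card; apply/card_le1_eqP => i j.
  by rewrite !unfold_in => /eqP-> /eqP/eqP; rewrite eqn_pmul2l // => /eqP/val_inj.
have : (N.+1 ^ n.+1 <= B * N.+1 ^ n)%N.
  apply: leq_trans (leq_exp_ffact _ _) _; rewrite -bin_ffact mulnC.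
  have -> : (B * N.+1 ^ n =
      (n.+1)`! * (#|{set 'I_k}| * ((e ^ n * N.+1 ^ n) * D ^ k)))%N.
    by rewrite /B -[LHS]mulnA -[LHS]mulnA -[in LHS]mulnA [(D ^ k * _)%N]mulnC.
  rewrite leq_mul2l; apply/orP; right.
  apply: leq_trans lower _; apply: leq_trans upper _.
  rewrite leq_mul2l; apply/orP; right; rewrite leq_mul2r; apply/orP; right.
  rewrite -expnMn; have [->|n_gt0] := posnP n; first by rewrite !expn0.
  by rewrite leq_exp2r // mulnS /A -add1n leq_add2r.
by rewrite expnS leq_mul2r expn_eq0 /= ltnn.
Qed.

(** Renaming n + 1 variables into J is injective on monomials and preserves the
    degree. *)
Lemma count_supported k n d (M : pred 'X_{1..k}) (J : {set 'I_k}) :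
    (n < #|J|)%N -> (forall mu, supported_on J mu -> M mu) ->
  ('C(n + d, d) <= count M (monomials k d))%N.
Proof.
move=> nJ JM; pose h (i : 'I_n.+1) : 'I_k := enum_val (widen_ord nJ i).
have h_inj : injective h by move=> i j /enum_val_inj /(congr1 val) /= /val_inj.
pose phi (mu : 'X_{1..n.+1}) : 'X_{1..k} :=
  [multinom (\sum_(j | h j == i) mu j)%N | i < k].
have phiE mu j : phi mu (h j) = mu j.
  by rewrite mnmE (eq_bigl (pred1 j)) ?big_pred1_eq // => i; rewrite (inj_eq h_inj).
rewrite -size_monomials -size_filter -(size_map phi); apply: uniq_leq_size.
  rewrite map_inj_uniq ?monomials_uniq // => mu nu E.
  by apply/mnmP => j; rewrite -!phiE E.
move=> _ /mapP[mu + ->]; rewrite mem_filter !mem_monomials => /eqP <-.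
rewrite JM /=; last first.
  move=> i iJ; rewrite mnmE big1 // => j /eqP hj; case/negP: iJ.
  by rewrite -hj enum_valP.
apply/eqP; rewrite !mdegE; under eq_bigr do rewrite mnmE.
rewrite (exchange_big_dep predT) //=; apply: eq_bigr => j _.
by rewrite (big_pred1 (h j)) // => i; rewrite eq_sym.
Qed.

(** * The two bounds on the Hilbert function *)

Lemma vanishing_standardM (K : fieldType) m (Z : set (pspace K m))
    (mu nu : 'X_{1..m.+1}) :
  standard (vanishing_on Z) (mu + nu)%MM -> standard (vanishing_on Z) mu.
Proof.
apply: contra => /asboolP[g [Zg homg g0 lg]]; apply/asboolP.
exists (g * 'X_[nu]); split.
- by move=> P ZP v vP v0; rewrite mevalM (Zg P) // mul0r.
- by rewrite mdegD; apply: dhomogM => //; rewrite dhomogX.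
- by rewrite mulf_neq0 // -msupp_eq0 msuppX.
- by rewrite mleadM ?mleadXm ?lg // -msupp_eq0 msuppX.
Qed.

Lemma hilbert_lower_bound (K : fieldType) m (Z : nat -> set (pspace K m)) n d :
    (forall j, (j <= n)%N -> zariski_closed (Z j) /\ zariski_irreducible (Z j)) ->
    (forall j, (j < n)%N -> (Z j `<` Z j.+1)%classic) ->
  ('C(n + d, d) <= count (standard (vanishing_on (Z n))) (monomials m.+1 d))%N.
Proof.
move=> Zirr ZS; have [e e_gt0 grow] := hilbert_growth Zirr ZS.
have [||J nJ Jstd] :=
    @growth_supported m.+1 n e (standard (vanishing_on (Z n))) _ e_gt0.
- exact: vanishing_standardM.
- move=> N; have [U NU ZU] := grow N; apply: leq_trans NU _.
  exact: dim_le_standard (vanishing_on_linear _) ZU.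
exact: count_supported nJ Jstd.
Qed.

Lemma mlead_map_mpoly (k K : fieldType) (iota : {rmorphism k -> K}) n
    (p : {mpoly k[n]}) : mlead (map_mpoly iota p) = mlead p.
Proof.
by apply: perm_big; apply: msupp_map_mpoly; apply: fmorph_inj.
Qed.

(** The leading monomials of the span of Fs over k are at least r in number, and
    none of them is standard for Z: the coefficient embedding preserves leading
    monomials and sends the span to forms vanishing on Z. *)
Lemma forms_le_leads (k K : fieldType) (iota : {rmorphism k -> K}) m d r
    (Fs : r.-tuple (dhomog m.+1 k d)) (Z : set (pspace K m)) :
    free Fs -> (Z `<=` proj_V iota Fs)%classic ->
  (r + count (standard (vanishing_on Z)) (monomials m.+1 d) <= 'C(m + d, d))%N.
Proof.
move=> Fs_free ZV; set std := standard _.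
rewrite -size_monomials -(count_predC std) addnC leq_add2l -size_filter.
rewrite -[r](size_tuple Fs); move/eqP: Fs_free => <-.
apply: dim_le_size_leads => u uF u0.
have Zu : vanishing_on Z (map_mpoly iota (val u)).
  rewrite (coord_span uF) raddf_sum /= rmorph_sum /=.
  move=> P ZP v vP v0; rewrite raddf_sum big1 //= => i _.
  rewrite map_mpolyZ mevalZ; apply/eqP; rewrite mulf_eq0; apply/orP; right.
  apply/eqP; apply: (ZV P ZP) => //; exists i => //=.
  by rewrite (tnth_nth 0).
rewrite mem_filter mem_monomials /= negbK.
have homu := valP u; have leadu := dhomog_mf homu (mlead_supp u0).
rewrite leadu eqxx andbT; apply/asboolP; exists (map_mpoly iota (val u)); split=> //.
- rewrite leadu; apply/dhomogP => mu.
  rewrite (perm_mem (msupp_map_mpoly _ (fmorph_inj iota))).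
  exact: (dhomog_mf homu).
- rewrite -msupp_eq0 -size_eq0 (perm_size (msupp_map_mpoly _ (fmorph_inj iota))).
  by rewrite size_eq0 msupp_eq0.
- exact: mlead_map_mpoly.
Qed.

Lemma irreducible_chain_le (k K : fieldType) (iota : {rmorphism k -> K}) m d l r
    (Fs : r.-tuple (dhomog m.+1 k d)) n :
    (1 <= l)%N -> (l <= m)%N -> ('C(m + d, d) - 'C(m + d + 1 - l, d) < r)%N ->
    free Fs -> irreducible_chain (proj_V iota Fs) n ->
  (n <= m - l)%N.
Proof.
move=> l1 lm r_gt Fs_free [Z [Zirr ZS]].
have [_ _ ZV] := Zirr n (leqnn n).
have le_r := forms_le_leads Fs_free ZV.
have le_std : ('C(n + d, d) <= _)%N :=
  hilbert_lower_bound d (fun j jn => let: And3 c i _ := Zirr j jn in conj c i) ZS.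
rewrite leqNgt; apply/negP => lt_n.
have le_bin : ('C(m + d + 1 - l, d) <= 'C(n + d, d))%N.
  by apply: leq_bin2l; lia.
lia.
Qed.

Theorem proposition4 (Fq : finFieldType)
    (K : closedFieldType) (iota : {rmorphism Fq -> K})
    (Kalg : integralRange iota)
    (m d l r : nat) (m_ge1 : (1 <= m)%N) (d_ge1 : (1 <= d)%N)
    (l_ge1 : (1 <= l)%N) (l_le_m : (l <= m)%N)
    (r_gt : ('C(m + d, d) - 'C(m + d + 1 - l, d) < r)%N)
    (r_le : (r <= 'C(m + d, d))%N)
    (Fs : r.-tuple (dhomog m.+1 Fq d)) (Fs_free : free Fs) :
  (proj_dim (proj_V iota Fs) <= EFin (m%:Z - l%:Z)%R)%O.
Proof.
have chain_le n : irreducible_chain (proj_V iota Fs) n -> (n <= m - l)%N.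
  exact: irreducible_chain_le.
(* Chain lengths are bounded, so the maximum that defines the dimension exists
   as soon as there is a chain. *)
rewrite /proj_dim; case: pselect => [[n0 chain0]|nochain]; last exact: leNye.
case: pselect => [maxX|nmax].
  case: (cid maxX) => n [chain_n _] /=.
  have := chain_le n chain_n; rewrite lee_fin; lia.
case: nmax.
have ex : exists n, `[< irreducible_chain (proj_V iota Fs) n >].
  by exists n0; apply/asboolP.
have ub n : `[< irreducible_chain (proj_V iota Fs) n >] -> (n <= m - l)%N.
  by move/asboolP/chain_le.
case: (ex_maxnP ex ub) => n /asboolP chain_n maxn; exists n; split=> // k chain_k.
by apply: maxn; apply/asboolP.
Qed.
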